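(* Let $A$ be a $C^*$-algebra, let $V$ be a Hilbert $A$-module, and let $(W,\mathcal{B},\Phi)$ be a Banach extension of $V$. Let $\Gamma_\Phi:\Phi(V)\to LM_{(W,\mathcal{B},\Phi)}(V)$ be the map $(\Gamma_\Phi(y))(a)=ya$ for $y\in\Phi(V)$, $a\in A$. Then the set $LM_{(W,\mathcal{B},\Phi)}(V)$ of all left $(W,\mathcal{B},\Phi)$-multipliers of $V$ coincides with the closure of the image $\Gamma_\Phi(\Phi(V))$ inside $\mathrm{Hom}_A(A,W)$ with respect to the left strict topology.
   Context: Hilbert $A$-modules are right modules; $A$ is viewed as a right module over itself. A Banach extension of a Hilbert $A$-module $V$ is a triple $(W,\mathcal{B},\Phi)$ where: (1) $\mathcal{B}$ is a Banach algebra and $A\subset\mathcal{B}$ is a $C^*$-subalgebra that is a left ideal (i.e. $\mathcal{B}A\subset A$); (2) $W$ is a (right) Banach $\mathcal{B}$-module; (3) $\Phi:V\to W$ is an $A$-linear isometric map; (4) $\mathrm{Im}\,\Phi=WA$, where $WA$ is the closed linear span of $\{ya: y\in W,a\in A\}$. $\mathrm{Hom}_A(A,W)$ (respectively $\mathrm{Hom}_A(A,\Phi(V))$) is the space of bounded $A$-linear operators from $A$ to $W$ (respectively to $\Phi(V)$), with the operator norm. For $S\in\mathrm{Hom}_A(A,W)$ and $a\in A$, $Sa\in\mathrm{Hom}_A(A,W)$ is defined by $(Sa)(b)=S(ab)$, $b\in A$. The left strict topology on $\mathrm{Hom}_A(A,W)$ is the one defined by the family of semi-norms $\nu_a(S)=\|Sa\|$,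 $a\in A$. The left $(W,\mathcal{B},\Phi)$-multipliers of $V$ are defined as $LM_{(W,\mathcal{B},\Phi)}(V)=\mathrm{Hom}_A(A,\Phi(V))$, viewed as a subspace of $\mathrm{Hom}_A(A,W)$. *)

(* Defs.v *)
From HB Require Import structures.
From mathcomp Require Import all_boot all_order all_algebra.
From mathcomp Require Import all_classical all_reals all_analysis.
From mathcomp Require Import complex.

Set Implicit Arguments.
Unset Strict Implicit.
Unset Printing Implicit Defensive.

Import Order.TTheory GRing.Theory Num.Theory.
Import numFieldNormedType.Exports.

Local Open Scope classical_set_scope.
Local Open Scope ring_scope.
Local Open Scope complex_scope.

(* Banach algebras need not have a unit, so the product cannot come from the
   ring structures of ssralg. *)
HB.mixin Record isBanachAlg (K : numFieldType) A & CompleteNormedModule K A := {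
  bmul : A -> A -> A;
  bmulA : associative bmul;
  bmulDl : left_distributive bmul +%R;
  bmulDr : right_distributive bmul +%R;
  bmulZl : forall (k : K) (a b : A), bmul (k *: a) b = k *: bmul a b;
  bmulZr : forall (k : K) (a b : A), bmul a (k *: b) = k *: bmul a b;
  norm_bmul_le : forall a b : A, `|bmul a b| <= `|a| * `|b|
}.

#[short(type="banachAlgType")]
HB.structure Definition BanachAlg (K : numFieldType) :=
  {A of CompleteNormedModule K A & isBanachAlg K A}.

Notation "a *b c" := (bmul a c) (at level 40, left associativity).

HB.mixin Record isCstarAlg (R : realType) A & BanachAlg R[i] A := {
  star : A -> A;
  starK : involutive star;
  starD : {morph star : a b / a + b};
  starZ : forall (k : R[i]) (a : A), star (k *: a) = Num.conj k *: star a;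
  starM : forall a b : A, star (a *b b) = star b *b star a;
  norm_starM : forall a : A, `|star a *b a| = `|a| ^+ 2
}.

#[short(type="cstarAlgType")]
HB.structure Definition CstarAlg (R : realType) :=
  {A of BanachAlg R[i] A & isCstarAlg R A}.

Definition cstar_nneg (R : realType) (A : cstarAlgType R) (a : A) : Prop :=
  exists b : A, a = star b *b b.

(* The inner product is conjugate-linear in its first argument (starZ and hip_star)
   and the completeness of V is that of its norm, fixed by norm_hip. *)
HB.mixin Record isHilbertMod (R : realType) (A : cstarAlgType R) V
    & CompleteNormedModule R[i] V := {
  hact : V -> A -> V;
  hactA : forall (x : V) (a b : A), hact x (a *b b) = hact (hact x a) b;
  hactDl : forall (x y : V) (a : A), hact (x + y) a = hact x a + hact y a;
  hactDr : forall (x : V) (a b : A), hact x (a + b) = hact x a + hact x b;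
  hactZl : forall (k : R[i]) (x : V) (a : A), hact (k *: x) a = k *: hact x a;
  hactZr : forall (k : R[i]) (x : V) (a : A), hact x (k *: a) = k *: hact x a;
  hip : V -> V -> A;
  hipDr : forall x y z : V, hip x (y + z) = hip x y + hip x z;
  hipZr : forall (k : R[i]) (x y : V), hip x (k *: y) = k *: hip x y;
  hip_act : forall (x y : V) (a : A), hip x (hact y a) = hip x y *b a;
  hip_star : forall x y : V, star (hip x y) = hip y x;
  hip_nneg : forall x : V, cstar_nneg (hip x x);
  hip_eq0 : forall x : V, hip x x = 0 -> x = 0;
  norm_hip : forall x : V, `|x| ^+ 2 = `|hip x x|
}.

#[short(type="hilbertModType")]
HB.structure Definition HilbertMod (R : realType) (A : cstarAlgType R) :=
  {V of CompleteNormedModule R[i] V & isHilbertMod R A V}.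

(* Contractive actions are the case M = 1 of bact_bounded. *)
HB.mixin Record isBanachMod (K : numFieldType) (B : banachAlgType K) W
    & CompleteNormedModule K W := {
  bact : W -> B -> W;
  bactA : forall (y : W) (b c : B), bact y (b *b c) = bact (bact y b) c;
  bactDl : forall (y z : W) (b : B), bact (y + z) b = bact y b + bact z b;
  bactDr : forall (y : W) (b c : B), bact y (b + c) = bact y b + bact y c;
  bactZl : forall (k : K) (y : W) (b : B), bact (k *: y) b = k *: bact y b;
  bactZr : forall (k : K) (y : W) (b : B), bact y (k *: b) = k *: bact y b;
  bact_bounded : exists M : K, forall (y : W) (b : B),
    `|bact y b| <= M * (`|y| * `|b|)
}.

#[short(type="banachModType")]
HB.structure Definition BanachMod (K : numFieldType) (B : banachAlgType K) :=
  {W of CompleteNormedModule K W & isBanachMod K B W}.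

Definition linear_span (K : numFieldType) (W : normedModType K) (X : set W) :
    set W :=
  [set x | exists (n : nat) (k : 'I_n -> K) (s : 'I_n -> W),
     (forall i, X (s i)) /\ x = \sum_(i < n) k i *: s i].

Definition closed_linear_span (K : numFieldType) (W : normedModType K)
  (X : set W) : set W := closure (linear_span X).

(* The inclusion of A in the Banach algebra is the isometric homomorphism bx_inc. *)
Record banachExt (R : realType) (A : cstarAlgType R) (V : hilbertModType A) := {
  bx_alg : banachAlgType R[i];
  bx_inc : {linear A -> bx_alg};
  bx_incM : {morph bx_inc : a b / a *b b >-> a *b b};
  bx_inc_isometry : forall a : A, `|bx_inc a| = `|a|;
  bx_left_ideal : forall (b : bx_alg) (a : A),
    exists c : A, b *b bx_inc a = bx_inc c;
  bx_mod : banachModType bx_alg;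
  bx_map : {linear V -> bx_mod};
  bx_map_act : forall (x : V) (a : A),
    bx_map (hact x a) = bact (bx_map x) (bx_inc a);
  bx_map_isometry : forall x : V, `|bx_map x| = `|x|;
  bx_range : range bx_map =
    closed_linear_span
      [set z | exists (y : bx_mod) (a : A), z = bact y (bx_inc a)]
}.

(* W is a right A-module through bx_inc; homA E is Hom_A(A, W). *)
Section HomA.
Context (R : realType) (A : cstarAlgType R) (V : hilbertModType A).
Variable E : banachExt V.
Local Notation W := (bx_mod E).
Local Notation inc := (bx_inc E).

Definition is_homA (f : A -> W) : Prop :=
  [/\ linear f,
      forall a b : A, f (a *b b) = bact (f a) (inc b)
    & exists M : R[i], forall a : A, `|f a| <= M * `|a|].

Definition is_homAb : {pred A -> W} := [pred f | `[< is_homA f >]].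

Record homA := HomA { homA_fun :> A -> W; _ : homA_fun \in is_homAb }.

HB.instance Definition _ := [isSub for homA_fun].
HB.instance Definition _ := [Choice of homA by <:].

Lemma homAP (S : homA) : is_homA S.
Proof. by apply/asboolP; exact: (valP S). Qed.

Definition mk_homA (f : A -> W) (hf : is_homA f) : homA :=
  HomA (introT (asboolP (is_homA f)) hf).

Lemma bounded_nneg (T U : normedModType R[i]) (f : T -> U) :
  (exists M : R[i], forall a, `|f a| <= M * `|a|) ->
  exists2 M : R[i], 0 <= M & forall a, `|f a| <= M * `|a|.
Proof.
move=> [M fM]; exists `|M| => // a.
have h0 : 0 <= M * `|a| by exact: le_trans (fM a).
by apply: le_trans (fM a) _; rewrite -(ger0_norm h0) normrM normr_id.
Qed.

Lemma is_homA_submod_closed : submod_closed is_homAb.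
Proof.
split.
  apply/asboolP; split => [k x y|a b|] /=.
  - by rewrite scaler0 addr0.
  - by have := bactZl 0 (0 : W) (inc b); rewrite !scale0r.
  - by exists 0 => a; rewrite normr0 mul0r.
move=> k f g /asboolP[fl fA fb] /asboolP[gl gA gb]; apply/asboolP.
split => [c x y|a b|].
- rewrite /= !fctE fl gl !scalerDr !scalerA (mulrC k c) -!addrA; congr (_ + _).
  by rewrite addrCA.
- by rewrite !fctE fA gA bactDl bactZl.
- have [M M0 fM] := bounded_nneg fb; have [N N0 gN] := bounded_nneg gb.
  exists (`|k| * M + N) => a; rewrite !fctE (le_trans (ler_normD _ _))//.
  rewrite mulrDl lerD// normrZ -mulrA ler_wpM2l//.
Qed.

HB.instance Definition _ :=
  GRing.isSubmodClosed.Build R[i] (A -> W) is_homAb is_homA_submod_closed.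
HB.instance Definition _ := [SubChoice_isSubLmodule of homA by <:].

(* Norms over R[i] take values in R[i]; complex.Re brings them back to R. *)
Definition opnorm (f : A -> W) : R :=
  sup [set complex.Re `|f a| | a in [set a : A | `|a| <= 1]].

Lemma homA_rmul_subproof (S : homA) (a : A) : is_homA (fun b => S (a *b b)).
Proof.
have [Sl SA Sb] := homAP S; split => [k x y|b c|].
- by rewrite bmulDr bmulZr Sl.
- by rewrite bmulA SA.
- have [M M0 SM] := bounded_nneg Sb; exists (M * `|a|) => b.
  by rewrite (le_trans (SM _))// -mulrA ler_wpM2l// norm_bmul_le.
Qed.

Definition homA_rmul (S : homA) (a : A) : homA :=
  mk_homA (homA_rmul_subproof S a).

Definition lstrict_seminorm (a : A) (S : homA) : R := opnorm (homA_rmul S a).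

(* A copy of homA carrying the left strict topology. *)
Definition homA_lstrict := homA.
HB.instance Definition _ := GRing.Lmodule.on homA_lstrict.

Definition lstrict_nbhs (S : homA_lstrict) : set_system homA_lstrict :=
  [set U | exists (s : seq A) (e : R), 0 < e /\
     [set T : homA_lstrict | forall a, a \in s ->
        lstrict_seminorm a (T - S) < e] `<=` U].

HB.instance Definition _ := hasNbhs.Build homA_lstrict lstrict_nbhs.

Lemma opnorm0 : opnorm 0 = 0.
Proof.
rewrite /opnorm (_ : [set _ | _ in _] = [set 0]) ?sup1//.
apply/seteqP; split => [_ [a _ <-]|_ ->] /=; first by rewrite normr0.
by exists 0; rewrite /= ?normr0.
Qed.

Lemma opnorm_has_sup (S : homA) :
  has_sup [set complex.Re `|S a| | a in [set a : A | `|a| <= 1]].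
Proof.
split; first by exists (complex.Re `|S 0|); exists 0; rewrite //= normr0.
have [_ _ /bounded_nneg[M M0 SM]] := homAP S.
exists (complex.Re M) => _ [a /= a1 <-].
have : `|S a| <= M by rewrite (le_trans (SM a))// ler_piMr.
by rewrite lecE => /andP[].
Qed.

Lemma opnormD (S T : homA) : opnorm (S + T) <= opnorm S + opnorm T.
Proof.
apply: sup_le_ub; first by case: (opnorm_has_sup (S + T)).
move=> _ [a /= a1 <-].
have : `|S a + T a| <= `|S a| + `|T a| by exact: ler_normD.
rewrite lecE => /andP[_] /le_trans; apply.
by rewrite raddfD lerD//; apply: ub_le_sup;
  do ?[by case: (opnorm_has_sup S)|by case: (opnorm_has_sup T)]; exists a.
Qed.

Lemma lstrict_seminormD (a : A) (S T : homA) :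
  lstrict_seminorm a (S + T) <= lstrict_seminorm a S + lstrict_seminorm a T.
Proof.
rewrite /lstrict_seminorm.
rewrite (_ : homA_rmul (S + T) a = homA_rmul S a + homA_rmul T a) ?opnormD//.
exact/val_inj.
Qed.

Lemma lstrict_seminorm0 (a : A) : lstrict_seminorm a 0 = 0.
Proof. exact: opnorm0. Qed.

Lemma lstrict_nbhs_filter (S : homA_lstrict) : ProperFilter (nbhs S).
Proof.
apply: Build_ProperFilter_ex => [U [s [e [e0 sU]]]|].
  by exists S; apply: sU => a _; rewrite subrr lstrict_seminorm0.
split.
- by exists [::], 1; split.
- move=> U U' [s [e [e0 sU]]] [s' [e' [e'0 sU']]].
  exists (s ++ s'), (Num.min e e'); split; first by rewrite lt_min e0.
  move=> T /= sT; split.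
    by apply: sU => a sa; have := sT a; rewrite mem_cat sa lt_min => /(_ isT)/andP[].
  by apply: sU' => a sa; have := sT a; rewrite mem_cat sa orbT lt_min => /(_ isT)/andP[].
- by move=> U U' UU' [s [e [e0 sU]]]; exists s, e; split => // T /sU/UU'.
Qed.

Lemma lstrict_nbhs_singleton (S : homA_lstrict) (U : set homA_lstrict) :
  nbhs S U -> U S.
Proof.
by move=> [s [e [e0]]]; apply => a _; rewrite subrr lstrict_seminorm0.
Qed.

Lemma lstrict_nbhs_nbhs (S : homA_lstrict) (U : set homA_lstrict) :
  nbhs S U -> nbhs S (nbhs^~ U).
Proof.
move=> [s [e [e0 sU]]]; exists s, (e / 2); split; first by rewrite divr_gt0.
move=> T sT; exists s, (e / 2); split; first by rewrite divr_gt0.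
move=> T' sT'; apply: sU => a sa.
rewrite -(subrK T T') -addrA (le_lt_trans (lstrict_seminormD _ _ _))//.
by rewrite [e]splitr ltrD// ?sT ?sT'.
Qed.

HB.instance Definition _ := Nbhs_isNbhsTopological.Build homA_lstrict
  lstrict_nbhs_filter lstrict_nbhs_singleton lstrict_nbhs_nbhs.

Definition left_multipliers : set homA_lstrict :=
  [set S | forall a : A, range (bx_map E) (S a)].

Lemma bx_Gamma_subproof (y : W) : is_homA (fun a => bact y (inc a)).
Proof.
split => [k a b|a b|].
- by rewrite linearP bactDr bactZr.
- by rewrite bx_incM bactA.
- have [M yM] := @bact_bounded _ _ W; exists (M * `|y|) => a.
  by rewrite -mulrA -(bx_inc_isometry E a).
Qed.

Definition bx_Gamma (y : W) : homA_lstrict := mk_homA (bx_Gamma_subproof y).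

Lemma bx_Gamma_left_multipliers (y : W) :
  range (bx_map E) y -> left_multipliers (bx_Gamma y).
Proof. by move=> [x _ <-] a; exists (hact x a); rewrite // bx_map_act. Qed.

End HomA.

Arguments left_multipliers {R A V} E.
Arguments bx_Gamma {R A V} E y.

(* Main.v *)
Require Import Defs.
From mathcomp Require Import all_boot all_order all_algebra.
From mathcomp Require Import all_classical all_reals all_analysis.
From mathcomp Require Import complex.

(** Both inclusions rest on one fact about the C*-algebra A: finitely many
    elements a admit a common approximate left unit, a u in A with every
    a - u a small ([approximate_left_unit]).

    Given such u, a multiplier S is approximated by b |-> y b with y = S u,
    which lies in the range of Phi: at a b the two differ by S ((a - u a) b),
    so their distance for the seminorm of a is at most |S| |a - u a|
    ([left_multipliers_sub_closure]).  Conversely, let S be a left strict limit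
    of maps b |-> y b with y in the range.  Then S (u a) is a norm limit of elements y (u a), which stay in the range,
    and S (u a) tends to S a as u a tends to a, because S is bounded.  The
    range is closed, so S a belongs to it ([closure_sub_left_multipliers]).

    The approximate left unit is produced from the axioms by elementary
    means, without spectra, positivity or a unit.  Write 1 - u for the operator
    x |-> x - u x on A, and let h be self-adjoint with |h| <= 1/2.
    - 1 + i h is inverted by a Neumann series ([quasi_inverse]), with inverse
      1 - v.  The Cayley transform U = (1 - i h) (1 + i h)^-1 = 1 - 2 v is an
      isometry, because the C*-identity gives |x + i h x| = |x - i h x|
      ([norm_cayley]).
    - Let 1 - u be the Cesaro mean of U^0, ..., U^(n-1).  It is a contraction
      and, by telescoping, (1 - u) (1 - U) is O(1/n) ([cesaro_quasi_unit]).
      As h b = (1 - U) g with |g| <= |b|, the element (1 - u) (h b) is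
      O(|b|/n) ([selfadjoint_left_unit]).
    - For h = a (star a), two applications of the C*-identity carry the smallness
      of (1 - u) (h b) over to (1 - u) h and then to (1 - u) a
      ([left_unit_at]).
    - As these operators 1 - u are contractions, they can be composed to treat
      finitely many a one after the other. *)

Set Implicit Arguments.
Unset Strict Implicit.
Unset Printing Implicit Defensive.

Import Order.TTheory GRing.Theory Num.Theory.
Import numFieldNormedType.Exports.

Local Open Scope classical_set_scope.
Local Open Scope ring_scope.

(** * Quasi-multiplication and Cesaro means in a Banach algebra *)

Section BanachAlgTheory.
Context (K : numFieldType) (A : banachAlgType K).
Implicit Types (a b u w x : A).

Lemma bmul0l x : (0 : A) *b x = 0.
Proof. by have := bmulZl 0 (0 : A) x; rewrite !scale0r. Qed.

Lemma bmulNl a x : (- a) *b x = - (a *b x).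
Proof. by rewrite -scaleN1r bmulZl scaleN1r. Qed.

Lemma bmulNr a x : a *b (- x) = - (a *b x).
Proof. by rewrite -scaleN1r bmulZr scaleN1r. Qed.

Lemma bmulBl a b x : (a - b) *b x = a *b x - b *b x.
Proof. by rewrite bmulDl bmulNl. Qed.

Lemma bmulBr a b x : x *b (a - b) = x *b a - x *b b.
Proof. by rewrite bmulDr bmulNr. Qed.

(** Without a unit, 1 - u only exists as the operator x |-> x - u x; these
    operators compose according to (1 - u) (1 - w) = 1 - (u + w - u w). *)
Lemma bmul_quasi_comp u w x :
  x - (u + w - u *b w) *b x = (x - w *b x) - u *b (x - w *b x).
Proof.
rewrite bmulBl bmulDl bmulBr bmulA !opprB opprD -!addrA; congr (x + _).
by rewrite [RHS]addrC -addrA.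
Qed.

(** With U = 1 - w and 1 - u = (1/n) (1 + U + ... + U^(n-1)), the sum telescopes
    on the image of 1 - U = w: (1 - u) w = (1/n) (1 - U^n). *)
Lemma cesaro_quasi_unit w (n : nat) :
  (forall x, `|x - w *b x| <= `|x|) -> (0 < n)%N ->
  exists2 u : A, (forall x, `|x - u *b x| <= `|x|) &
    forall g, `|w *b g - u *b (w *b g)| <= 2 / n%:R * `|g|.
Proof.
move=> w1 n0.
(* n - s is the sum of the first n powers of 1 - w, and 1 - p is the n-th. *)
have [s [p [p1 s1 sw]]] : exists s p : A, [/\ forall x, `|x - p *b x| <= `|x|,
    forall x, `|n%:R *: x - s *b x| <= n%:R * `|x|
  & forall g, n%:R *: (w *b g) - s *b (w *b g) = p *b g].
  elim: n {n0} => [|n [s [p [p1 s1 sw]]]].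
    exists 0, 0; split => [x|x|g]; rewrite ?bmul0l ?scale0r ?subr0 //.
    by rewrite normr0 mul0r.
  exists (s + p), (p + w - p *b w); split => [x|x|g].
  - by rewrite bmul_quasi_comp (le_trans (p1 _)).
  - rewrite -natr1 scalerDl scale1r bmulDl opprD addrACA mulrDl mul1r.
    by rewrite (le_trans (ler_normD _ _))// lerD.
  - rewrite -natr1 scalerDl scale1r bmulDl opprD addrACA sw.
    by rewrite bmulBl bmulDl bmulA !addrA.
have n00 : n%:R != 0 :> K by rewrite pnatr_eq0 -lt0n.
have nE x : x - (n%:R^-1 *: s) *b x = n%:R^-1 *: (n%:R *: x - s *b x).
  by rewrite scalerBr scalerA mulVf// scale1r bmulZl.
exists (n%:R^-1 *: s) => [x|g]; rewrite nE normrZ normfV normr_nat.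
  by rewrite ler_pdivrMl ?ltr0n.
rewrite sw mulrAC -[leRHS]mulrC ler_wpM2l ?invr_ge0 ?ler0n//.
rewrite -[p *b g](subrK g) addrC (le_trans (ler_normD _ _))//.
by rewrite mulrDl mul1r lerD// -normrN opprB p1.
Qed.

End BanachAlgTheory.

(** * Neumann series *)

Section QuasiInverse.
Context (R : realType).

Lemma posC_inv_nat_lt (e : R[i]) : 0 < e -> exists n : nat, n.+1%:R^-1 < e.
Proof.
case: e => e e'; rewrite ltcE /= => /andP[/eqP -> e0].
exists (Num.truncn e^-1).
have : ((Num.truncn e^-1).+1%:R^-1)%:C%C < e%:C%C.
  rewrite ltcR -[ltRHS]invrK ltf_pV2 ?(posrE,invr_gt0,ltr0n)//.
  exact: truncnS_gt.
by rewrite fmorphV rmorph_nat.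
Qed.

Lemma cauchy_seq_limit (V : completeNormedModType R[i]) (u : nat -> V) :
  (forall e : R[i], 0 < e -> exists N, forall m, (N <= m)%N -> `|u N - u m| < e) ->
  exists l : V, forall e : R[i], 0 < e ->
    exists N, forall m, (N <= m)%N -> `|l - u m| < e.
Proof.
move=> cu.
have cv : cvg (u @ \oo).
  apply: cauchy_cvg; apply: cauchy_exP => e e0.
  have [N uN] := cu e e0; exists (u N), N => // m Nm.
  by rewrite /= -ball_normE /=; exact: uN.
exists (lim (u @ \oo)) => e e0.
have /cvgrPdist_lt/(_ e e0)[N _ uN] := cv.
by exists N => m Nm; exact: uN.
Qed.

(** The equation says (1 + c) (1 - v) = 1; its solution is the fixed point of the
    contraction v |-> c - c v. *)
Lemma quasi_inverse (A : banachAlgType R[i]) (c : A) : `|c| <= 2^-1 ->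
  exists v : A, v + c *b v = c.
Proof.
move=> c2.
pose u := fix u n : A := if n is n'.+1 then c - c *b u n' else 0.
have h2 : 0 < 2^-1 :> R[i] by rewrite invr_gt0 ltr0n.
have cM x : `|c *b x| <= 2^-1 * `|x|.
  by rewrite (le_trans (norm_bmul_le _ _))// ler_wpM2r.
have u1 n : `|u n| <= 1.
  elim: n => [|n IH] /=; first by rewrite normr0.
  rewrite (le_trans (ler_normB _ _))// (splitr 1) lerD//.
    by rewrite div1r.
  by rewrite (le_trans (cM _))// div1r ler_piMr// ltW.
(* u (n + m) and u n arise from u m and u 0 by n steps of a map contracting
   by 1/2. *)
have ud n m : `|u n - u (n + m)%N| <= 2^-1 ^+ n.
  elim: n => [|n IH]; first by rewrite sub0r normrN expr0 add0n.
  rewrite addSn /= opprB addrC addrA subrK -bmulBr.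
  by rewrite (le_trans (cM _))// exprS ler_wpM2l ?(ltW h2)// distrC.
have [e e0|v vu] := @cauchy_seq_limit A u.
  have [n ne] := posC_inv_nat_lt e0; exists n => m nm.
  rewrite -(subnKC nm) (le_lt_trans (ud _ _))// (le_lt_trans _ ne)//.
  rewrite exprVn lef_pV2 ?posrE ?exprn_gt0 ?ltr0n//.
  by rewrite -natrX ler_nat ltn_expl.
exists v; apply/eqP; rewrite -subr_eq0 -normr_le0.
apply: contraT => H.
have {}H : 0 < `|v + c *b v - c|.
  by rewrite lt_def normr_ge0 andbT; apply: contra H => /eqP ->.
have [N vN] := vu _ (divr_gt0 H (ltr0n _ 2)).
suff : `|v + c *b v - c| < `|v + c *b v - c| by rewrite ltxx.
have vE : v + c *b v - c = (v - u N.+1) + c *b (v - u N).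
  rewrite /= bmulBr opprB -addrA -[in RHS]addrA; congr (v + _).
  by rewrite [RHS]addrC addrA subrK.
rewrite {1}vE; have N1 := vN _ (leqnSn N); have N0 := vN _ (leqnn N).
rewrite (le_lt_trans (ler_normD _ _))// [ltRHS]splitr ltr_leD//.
rewrite (le_trans (cM _))// (le_trans _ (ltW N0))// ler_piMl//.
by rewrite invf_le1 ?ltr0n// ler1n.
Qed.

End QuasiInverse.

(** * Approximate left units in a C*-algebra *)

Section CstarApproximateUnit.
Context (R : realType) (A : cstarAlgType R).
Implicit Types (a b h x : A).

Lemma starN a : star (- a) = - star a.
Proof. by rewrite -scaleN1r starZ rmorphN1 scaleN1r. Qed.

Lemma starB a b : star (a - b) = star a - star b.
Proof. by rewrite starD starN. Qed.

Lemma norm_star a : `|star a| = `|a|.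
Proof.
have le b : `|b| <= `|star b|.
  have [->|b0] := eqVneq b 0; first by rewrite normr0.
  have bp : 0 < `|b| by rewrite normr_gt0.
  by rewrite -(ler_pM2r bp) -expr2 -norm_starM norm_bmul_le.
by apply: le_anti; rewrite le -{2}(starK a) le.
Qed.

Lemma norm_Mstar a : `|a *b star a| = `|a| ^+ 2.
Proof. by rewrite -{1}(starK a) norm_starM norm_star. Qed.

(** By the C*-identity both norms are determined by
    star (x + t h x) (x + t h x) = (star x) x - t^2 (star x) h h x, in which the
    cross terms cancel because conj t = - t and star h = h; only t^2 is left. *)
Lemma norm_cayley h x (t : R[i]) : star h = h -> Num.conj t = - t ->
  `|x - t *: (h *b x)| = `|x + t *: (h *b x)|.
Proof.
move=> hh tt.
have E s : Num.conj s = - s -> star (x + s *: (h *b x)) *b (x + s *: (h *b x)) =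
    star x *b x - s ^+ 2 *: (star x *b (h *b (h *b x))).
  move=> ss; rewrite starD starZ starM hh ss scaleNr bmulBl !bmulDr.
  rewrite !bmulZl !bmulZr !bmulA scalerA -expr2.
  by rewrite opprD addrA addrK.
apply/eqP; rewrite -(@eqrXn2 _ 2)//; apply/eqP.
have tN : Num.conj (- t) = - - t by rewrite rmorphN /= tt.
by rewrite -scaleNr -!norm_starM (E _ tt) (E _ tN) sqrrN.
Qed.

(** Here 1 - u is a Cesaro mean of the Cayley transform of h.  The estimate
    concerns h b rather than h: writing h = (1 - U) g would take g in the
    unitization, while h b = (1 - U) g has a solution g in A. *)
Lemma selfadjoint_left_unit h (e : R[i]) : star h = h -> `|h| <= 2^-1 -> 0 < e ->
  exists2 u : A, (forall x, `|x - u *b x| <= `|x|) &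
    forall b, `|h *b b - u *b (h *b b)| <= e * `|b|.
Proof.
move=> hh h2 e0.
have ci : Num.conj ('i : R[i]) = - 'i by exact: conjCi.
have [|v vE] := @quasi_inverse _ A ('i *: h); first by rewrite normrZ normCi mul1r.
have Rinv x : (x - v *b x) + 'i *: (h *b (x - v *b x)) = x.
  rewrite -bmulZl bmulBr -{1}vE bmulDl bmulA addrK.
  exact: subrK.
(* Multiplication by 1 - v is a right inverse of 1 + i h, and
   1 - (1 + i h)^-1 = i h (1 + i h)^-1. *)
have ihR x : 'i *: (h *b (x - v *b x)) = v *b x.
  by apply: (addrI (x - v *b x)); rewrite Rinv subrK.
(* The Cayley transform: (1 - i h) (1 - v) = 1 - 2 v. *)
have cay x : `|x - (2 *: v) *b x| = `|x|.
  rewrite -[in RHS](Rinv x) -(norm_cayley _ hh ci) ihR bmulZl.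
  by rewrite scaler_nat -addrA -opprD -mulr2n.
(* If (1 + i h) d = 0 then (1 - i h) d = 0 as well, so that 2 d = 0. *)
have inj d : d + 'i *: (h *b d) = 0 -> d = 0.
  move=> d0; have /eqP := norm_cayley d hh ci.
  rewrite d0 normr0 normr_eq0 subr_eq0 => /eqP dh.
  move: d0; rewrite -dh -mulr2n -(scaler_nat _ d) => /eqP.
  by rewrite scaler_eq0 pnatr_eq0 => /eqP.
(* By injectivity 1 - v is also a left inverse of 1 + i h.  Hence
   x = (1 + i h) b satisfies (1 - v) x = b, which gives v x = x - b = i h b. *)
have hb b : exists2 g, `|g| <= `|b| & h *b b = (2 *: v) *b g.
  pose x := b + 'i *: (h *b b).
  have xb : x - v *b x = b.
    apply/eqP; rewrite -subr_eq0; apply/eqP; apply: inj.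
    by rewrite bmulBr scalerBr addrACA Rinv -opprD subrr.
  have vx : v *b x = 'i *: (h *b b).
    by apply: (addIr (- x)); rewrite -opprB xb /x opprD addrCA subrr addr0.
  exists ((2^-1 * - 'i) *: x).
    rewrite normrZ normrM normrN normCi mulr1 normfV normr_nat ler_pdivrMl ?ltr0n//.
    rewrite (le_trans (ler_normD _ _))// normrZ normCi mul1r mulr_natl mulr2n.
    rewrite lerD// (le_trans (norm_bmul_le _ _))// ler_piMl//.
    by rewrite (le_trans h2)// invf_le1 ?ltr0n// ler1n.
  rewrite bmulZl bmulZr vx !scalerA mulrA mulfV ?pnatr_eq0// mul1r mulNr.
  by rewrite -expr2 sqrCi opprK scale1r.
have [n ne] := posC_inv_nat_lt (divr_gt0 e0 (ltr0n _ 2)).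
have w1 x : `|x - (2 *: v) *b x| <= `|x| by rewrite cay.
have [u u1 uE] := cesaro_quasi_unit w1 (ltn0Sn n).
exists u => // b; have [g gb ->] := hb b.
rewrite (le_trans (uE _))// ler_pM ?divr_ge0 ?ler0n//.
by rewrite mulrC -ler_pdivlMr ?ltr0n// ltW.
Qed.

(** Take u for h = a (star a).  With z = (1 - u) h one has
    z (star z) = (1 - u) (h (star z)), so |z|^2 is at most a small
    multiple of |z|.  With y = (1 - u) a one has
    a (star y) = h - h (star u) = star z, hence y (star y) = (1 - u) (star z)
    and |y|^2 <= |z|.
    The contractivity of 1 - u is kept for later composition. *)
Lemma left_unit_at a (e : R[i]) : 0 < e ->
  exists2 u : A, (forall x, `|x - u *b x| <= `|x|) & `|a - u *b a| < e.
Proof.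
(* The estimate is homogeneous in a, so a can be scaled to norm at most 1/2. *)
wlog a2 : a e / `|a| <= 2^-1 => [wl|] e0.
  have c0 : 0 < (2 * (1 + `|a|))^-1 by rewrite invr_gt0 mulr_gt0 ?ltr0n// ltr_pwDl.
  have [||u u1 ua] := wl ((2 * (1 + `|a|))^-1 *: a) ((2 * (1 + `|a|))^-1 * e).
  - rewrite normrZ gtr0_norm// invfM -mulrA ler_piMr ?invr_ge0 ?ler0n//.
    by rewrite ler_pdivrMl ?ltr_pwDl// mulr1 lerDr.
  - exact: mulr_gt0.
  exists u => //; move: ua.
  by rewrite bmulZr -scalerBr normrZ gtr0_norm// ltr_pM2l.
pose h := a *b star a.
have hh : star h = h by rewrite starM starK.
have h2 : `|h| <= 2^-1.
  rewrite norm_Mstar expr2 (le_trans _ a2)// ler_piMr// (le_trans a2)//.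
  by rewrite invf_le1 ?ltr0n// ler1n.
have d0 : 0 < (e / 2) ^+ 2 by rewrite exprn_gt0// divr_gt0.
have [u u1 uh] := selfadjoint_left_unit hh h2 d0; exists u => //.
pose z := h - u *b h.
have zd : `|z| <= (e / 2) ^+ 2.
  have [->|z0] := eqVneq z 0; first by rewrite normr0 ltW.
  have zp : 0 < `|z| by rewrite normr_gt0.
  rewrite -(ler_pM2r zp) -expr2 -norm_Mstar {1}/z bmulBl -bmulA.
  by rewrite (le_trans (uh _))// norm_star.
pose y := a - u *b a.
suff : `|y| <= e / 2.
  by move=> /le_lt_trans; apply; rewrite ltr_pdivrMr ?ltr0n// ltr_pMr// ltr1n.
have e2 : 0 <= e / 2 by rewrite divr_ge0 ?ler0n// ltW.
rewrite -(@ler_pXn2r _ 2) ?nnegrE//.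
rewrite -norm_Mstar (le_trans _ zd)//.
have ay : a *b star y = star z.
  by rewrite /y /z !starB bmulBr (starM u a) (starM u h) hh bmulA.
by rewrite {1}/y bmulBl -bmulA ay (le_trans (u1 _))// norm_star.
Qed.

(** If v serves the tail s and u serves a - v a, then (1 - u) (1 - v) serves
    a :: s: the contraction 1 - u preserves what 1 - v achieved on s. *)
Lemma approximate_left_unit (s : seq A) (e : R[i]) : 0 < e ->
  exists u : A, forall a, a \in s -> `|a - u *b a| < e.
Proof.
elim: s e => [|a s IH] e e0; first by exists 0.
have [v vs] := IH _ e0.
have [u u1 ua] := left_unit_at (a - v *b a) e0.
exists (u + v - u *b v) => x; rewrite inE => /predU1P[->|xs]; rewrite bmul_quasi_comp//.
by rewrite (le_lt_trans (u1 _))// vs.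
Qed.

End CstarApproximateUnit.

(** * Left multipliers and the left strict topology *)

Section LeftMultipliers.
Context (R : realType) (A : cstarAlgType R) (V : hilbertModType A).
Variable E : banachExt V.

Lemma homAZ (S : homA E) k a : S (k *: a) = k *: S a.
Proof. by have [Sl _ _] := homAP S; exact: scalable_linear. Qed.

Lemma homAB (S : homA E) a b : S (a - b) = S a - S b.
Proof. by have [Sl _ _] := homAP S; exact: (zmod_morphism_linear Sl). Qed.

Lemma opnorm_le (S : homA E) (a : A) :
  `|S a| <= (opnorm S)%:C%C * `|a|.
Proof.
have [->|a0] := eqVneq a 0.
  have S0 : S 0 = 0 by rewrite -{1}(subrr (0 : A)) homAB subrr.
  by rewrite S0 !normr0 mulr0.
have ap : 0 < `|a| by rewrite normr_gt0.
rewrite -ler_pdivrMr// mulrC -{1}(gtr0_norm ap) -normfV -normrZ -homAZ.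
have rn (V' : normedModType R[i]) (x : V') : `|x| = (complex.Re `|x|)%:C%C.
  by rewrite RRe_real// ger0_real.
rewrite rn lecR; apply: ub_le_sup; first by case: (opnorm_has_sup S).
exists (`|a|^-1 *: a) => //=.
by rewrite normrZ normfV normr_id mulVf// gt_eqF.
Qed.

Lemma opnorm_lt (S : homA E) (M e : R[i]) :
  (forall a, `|S a| <= M * `|a|) -> 0 <= M -> M < e -> ((opnorm S)%:C)%C < e.
Proof.
move=> SM M0 Me; apply: le_lt_trans Me.
have -> : M = (complex.Re M)%:C%C by rewrite RRe_real// ger0_real.
rewrite lecR; apply: sup_le_ub; first by case: (opnorm_has_sup S).
move=> _ [a /= a1 <-].
have : `|S a| <= M by rewrite (le_trans (SM a))// ler_piMr.
by rewrite lecE => /andP[].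
Qed.

Lemma homA_act (S : homA E) a b : S (a *b b) = bact (S a) (bx_inc E b).
Proof. by have [_ SA _] := homAP S. Qed.

Lemma homA_bounded (S : homA E) :
  exists2 M : R[i], 0 <= M & forall a, `|S a| <= M * `|a|.
Proof. by have [_ _ /bounded_nneg] := homAP S. Qed.

(** The range of Phi is the closed linear span WA. *)
Lemma closed_range_bx_map : closed (range (bx_map E)).
Proof. by rewrite bx_range; exact: closed_closure. Qed.

(** The map b |-> (S u) b is b |-> S (u b), so it is close to S on
    every a b for which u a is close to a. *)
Lemma left_multipliers_sub_closure :
  left_multipliers E `<=` closure (bx_Gamma E @` range (bx_map E)).
Proof.
move=> S LS B [s [e [e0 sB]]].
have [M M0 SM] := homA_bounded S.
have M1 : 0 < M + 1 by rewrite ltr_wpDl.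
have eC : 0 < e%:C%C :> R[i] by rewrite ltcR.
have [u us] := approximate_left_unit s (divr_gt0 eC M1).
exists (bx_Gamma E (S u)); split; first by exists (S u).
apply: sB => a sa; rewrite /lstrict_seminorm -ltcR.
(* M + 1 rather than M in the denominator, as M may be 0. *)
apply: (@opnorm_lt _ (M * (e%:C%C / (M + 1)))) => [b||].
- have -> : homA_rmul (bx_Gamma E (S u) - S : homA E) a b = - S ((a - u *b a) *b b).
    by rewrite bmulBl -bmulA homAB opprB (homA_act S u).
  rewrite normrN (le_trans (SM _))// -mulrA ler_wpM2l//.
  by rewrite (le_trans (norm_bmul_le _ _))// ler_wpM2r// ltW// us.
- by rewrite mulr_ge0// divr_ge0// ltW.
- by rewrite mulrCA gtr_pMr// ltr_pdivrMr// mul1r ltrDl.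
Qed.

(** The left strict topology controls S only on products u a; an approximate
    left unit u for a makes S (u a) close to S a. *)
Lemma closure_sub_left_multipliers :
  closure (bx_Gamma E @` range (bx_map E)) `<=` left_multipliers E.
Proof.
move=> S clS a; rewrite [range _](iffLR (closure_id _) closed_range_bx_map).
move=> B /nbhs_normP[e /= e0 eB].
have [M M0 SM] := homA_bounded S.
have M1 : 0 < M + 1 by rewrite ltr_wpDl.
have e2 : 0 < e / 2 by rewrite divr_gt0.
have [u ua] := approximate_left_unit [:: a] (divr_gt0 e2 M1).
have {}ua := ua a (mem_head _ _).
have a1 : 0 < `|a| + 1 by rewrite ltr_wpDl.
pose d := e / 2 / (`|a| + 1).
have d0 : 0 < d by rewrite divr_gt0.
have dE : d = (complex.Re d)%:C%C by rewrite RRe_real// ger0_real// ltW.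
have [|T [[y [x _ <-] <-] TS]] := clS
    [set T : homA_lstrict E | lstrict_seminorm u (T - S) < complex.Re d].
  exists [:: u], (complex.Re d); split; first by rewrite -ltcR -dE.
  by move=> T; apply; rewrite mem_head.
exists (bact (bx_map E x) (bx_inc E (u *b a))); split.
  by exists (hact x (u *b a)) => //; rewrite bx_map_act.
apply: eB; rewrite /= -(subrK (S (u *b a)) (S a)) -addrA.
rewrite (le_lt_trans (ler_normD _ _))// [ltRHS]splitr ltr_leD//.
  rewrite -homAB (le_lt_trans (SM _))//.
  rewrite (le_lt_trans (ler_wpM2l M0 (ltW ua)))//.
  by rewrite mulrCA gtr_pMr// ltr_pdivrMr// mul1r ltrDl.
rewrite distrC.
rewrite (le_trans (opnorm_le (homA_rmul (bx_Gamma E (bx_map E x) - S : homA E) u) a))//.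
rewrite (@le_trans _ _ (d * `|a|))//.
  by rewrite ler_wpM2r// dE lecR ltW.
by rewrite /d mulrAC ler_pdivrMr// ler_wpM2l ?ltW// ltrDl.
Qed.

End LeftMultipliers.

Theorem theorem6p9 (R : realType) (A : cstarAlgType R) (V : hilbertModType A)
    (E : banachExt V) :
  left_multipliers E = closure (bx_Gamma E @` range (bx_map E)).
Proof.
apply/seteqP; split; first exact: left_multipliers_sub_closure.
exact: closure_sub_left_multipliers.
Qed.
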